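(* Let $d\ge 1$ and let $\overline{q}\ge 4$ be an even integer. There exist $\delta_0>0$ and $\rho>0$ depending on $\overline{q}$ and $d$ such that the following holds. Let $q\in(3,\infty)$ with $|q-\overline{q}|\le\rho$, let $n>0$ and $p\ge 1$, and suppose that there is a constant $c_{q,d}>0$ such that $$\|\widehat{f1_{\mathbb{B}}}\|_q^q\le\|\widehat{1_{\mathbb{B}}}\|_q^q-c_{q,d}\|f-1\|_{L^p(\mathbb{B})}^n$$ for all measurable real-valued $f$ with $0\le f\le 1$ and $\|f-1\|_{L^1(\mathbb{B})}\le\delta_0$. Then $n\ge p$.
   Context: The Fourier transform is $\widehat{f}(\xi)=\int_{\mathbb{R}^d}e^{-2\pi i x\cdot\xi}f(x)\,dx$, and $\mathbb{B}$ is the unit ball of $\mathbb{R}^d$ centered at the origin. Here $p$ is an arbitrary exponent, not the conjugate of $q$. *)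

(* Defs.v *)
From HB Require Import structures.
From mathcomp Require Import all_boot all_order all_algebra.
From mathcomp Require Import all_classical all_reals all_analysis.
From mathcomp Require Import complex.

Set Implicit Arguments.
Unset Strict Implicit.
Unset Printing Implicit Defensive.

Import Order.TTheory GRing.Theory Num.Theory.
Import numFieldNormedType.Exports.

Local Open Scope classical_set_scope.
Local Open Scope ring_scope.

(* R^d with the library's product sigma-algebra, that is, its Borel sets.     *)
(* The coordinates are in [measurableTypeR R], an alias of R, because that is *)
(* the measurable type on which [lebesgue_measure] is defined.                *)
Notation Rn R d := (d.-tuple (measurableTypeR R)).

(* The Lebesgue measure of R^d, by recursion on d: for d = n.+1 it is the     *)
(* image of the product measure on R * R^n by the isomorphism [consT].        *)
Section lebesgue_measure_tuple.
Context {R : realType}.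

Definition consT n (x : measurableTypeR R * Rn R n) : Rn R n.+1 :=
  [tuple of x.1 :: x.2].

Definition unconsT n (t : Rn R n.+1) : measurableTypeR R * Rn R n :=
  (thead t, [tuple of behead t]).

Lemma consTK n : cancel (@consT n) (@unconsT n).
Proof.
by case=> x t; rewrite /unconsT /consT theadE; congr pair; exact: val_inj.
Qed.

Lemma unconsTK n : cancel (@unconsT n) (@consT n).
Proof. by move=> t; rewrite /consT /unconsT /= [RHS]tuple_eta. Qed.

Lemma measurable_consT n : measurable_fun setT (@consT n).
Proof. exact: measurable_cons. Qed.

Lemma measurable_unconsT n : measurable_fun setT (@unconsT n).
Proof.
apply/measurable_fun_pair; last exact: measurable_behead.
exact: (measurable_tnth ord0).
Qed.

Section image_consT.
Context n (m : {sigma_finite_measure set (Rn R n) -> \bar R}).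

Let mu : {measure set (measurableTypeR R * Rn R n)%type -> \bar R} :=
  (@lebesgue_measure R \x m)%E.

Definition image_consT : set (Rn R n.+1) -> \bar R :=
  pushforward (@lebesgue_measure R \x m)%E (@consT n).

Let image_consT0 : image_consT set0 = 0%E.
Proof. by rewrite /image_consT /pushforward preimage_set0 measure0. Qed.

Let image_consT_ge0 A : (0 <= image_consT A)%E.
Proof. exact: (measure_ge0 mu). Qed.

Let image_consT_sigma_additive : semi_sigma_additive image_consT.
Proof.
move=> F mF tF mUF; rewrite /image_consT /pushforward preimage_bigcup.
apply: (measure_semi_sigma_additive (s := mu)).
- by move=> k; rewrite -[X in measurable X]setTI; exact: measurable_consT.
- apply/trivIsetP => /= i j _ _ ij; rewrite -preimage_setI.
  by move/trivIsetP : tF => /(_ _ _ _ _ ij) ->//; rewrite preimage_set0.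
- by rewrite -preimage_bigcup -[X in measurable X]setTI; exact: measurable_consT.
Qed.

HB.instance Definition _ := isMeasure.Build _ _ _ image_consT
  image_consT0 image_consT_ge0 image_consT_sigma_additive.

Let image_consT_sigma_finite : sigma_finite setT image_consT.
Proof.
have /sigma_finiteP[F [TF ndF Foo]] := sigma_finiteT (@lebesgue_measure R).
have /sigma_finiteP[G [TG ndG Goo]] := sigma_finiteT m.
exists (fun i => @unconsT n @^-1` (F i `*` G i)).
  rewrite -preimage_bigcup -[LHS](preimage_setT (@unconsT n)); congr (_ @^-1` _).
  rewrite -setXTT TF TG predeqE => -[x y]; split.
    move=> [/= [i _ Fix] [k _ Gky]]; exists (maxn i k) => //; split.
    - by move: x Fix; exact/subsetPset/ndF/leq_maxl.
    - by move: y Gky; exact/subsetPset/ndG/leq_maxr.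
  by move=> [i _ []/= ? ?]; split; exists i.
move=> i; have [mFi Fioo] := Foo i; have [mGi Gioo] := Goo i; split.
  rewrite -[X in measurable X]setTI; apply: measurable_unconsT => //.
  exact: measurableX.
rewrite /image_consT /pushforward -comp_preimage.
rewrite (_ : _ \o _ = id); last by apply/funext => x; exact: consTK.
by rewrite preimage_id product_measure1E// lte_mul_pinfty// ge0_fin_numE.
Qed.

HB.instance Definition _ := Measure_isSigmaFinite.Build _ _ _ image_consT
  image_consT_sigma_finite.

End image_consT.

Fixpoint lebesgue_measure_tuple d :
    {sigma_finite_measure set (Rn R d) -> \bar R} :=
  if d is n.+1
  then image_consT (lebesgue_measure_tuple n)
  else @dirac _ (Rn R 0) [tuple] R.

Lemma lebesgue_measure_tuple_box d (A : 'I_d -> set (measurableTypeR R)) :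
  (forall i, measurable (A i)) ->
  lebesgue_measure_tuple d [set x | forall i, A i (tnth x i)] =
  (\prod_(i < d) lebesgue_measure (A i))%E.
Proof.
elim: d A => [|n IHn] A mA.
  by rewrite big_ord0 /= diracE mem_set// => -[].
rewrite big_ord_recl -IHn; last by move=> i; exact: mA.
rewrite /= -product_measure1E//; last first.
  rewrite (_ : [set _ | _] =
      \bigcap_(i : 'I_n) (@tnth _ _ ^~ i) @^-1` A (lift ord0 i)).
    apply: fin_bigcap_measurable => [|i _]; first exact: finite_finset.
    by rewrite -[X in measurable X]setTI; exact: measurable_tnth.
  by apply/seteqP; split => t /= At i => [_|]; exact: At.
rewrite /image_consT /pushforward; congr (product_measure1 _ _ _).
apply/seteqP; split => -[x t] /=.
  move=> Axt; split; first exact: (Axt ord0).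
  by move=> i; have := Axt (lift ord0 i); rewrite tnthS.
move=> [Ax At] i; case: (unliftP ord0 i) => [j ->|->]//.
by rewrite tnthS; exact: At.
Qed.

End lebesgue_measure_tuple.

Section fourier.
Context {R : realType} {d : nat}.
Implicit Types (x xi : Rn R d) (f : Rn R d -> R).

Definition dotT x xi : R := \sum_(i < d) (tnth x i : R) * (tnth xi i : R).

Definition unit_ball : set (Rn R d) := [set x | Num.sqrt (dotT x x) <= 1].

Definition expi (t : R) : R[i] := (cos t +i* sin t)%C.

Definition fourier f xi : R[i] :=
  let g x := expi (- (2 * pi * dotT x xi)) * ((f x)%:C)%C in
  ((\int[lebesgue_measure_tuple d]_x complex.Re (g x))%R +i*
   (\int[lebesgue_measure_tuple d]_x complex.Im (g x))%R)%C.

Definition LnormC (p : R) (g : Rn R d -> R[i]) : \bar R :=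
  'N[lebesgue_measure_tuple d]_p%:E [EFin \o (@ComplexField.Normc.normc R \o g)]%E.

Definition Lnorm_ball (p : R) (f : Rn R d -> R) : \bar R :=
  'N[lebesgue_measure_tuple d]_p%:E [EFin \o (f \* \1_unit_ball)%R]%E.

End fourier.

Arguments unit_ball R d : clear implicits.

(* Main.v *)
(* Remove a cube E = [0,s]^d from the ball B. Young's inequality               *)
(* a^q <= b^q + q a^(q-1) (a - b), with a and b the moduli of the Fourier      *)
(* transforms of 1_B and 1_(B \ E), which differ by at most 2|E|, shows that   *)
(* the q-th power of the L^q norm drops by at most K |E|, where                *)
(* K = 2 q \int a^(q-1). Now K is finite because q - 1 > 2, a is bounded, and  *)
(* a is in L^2. As ||1_(B \ E) - 1||_p^n = |E|^(n/p), the assumed inequality   *)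
(* gives c |E|^(n/p) <= K |E| for all small cubes, whence n >= p.              *)
(* For the L^2 bound, the weighted integral of a^2 against                     *)
(* exp (- e (|xi_1| + ... + |xi_d|)) is a double integral over B x B of a      *)
(* product of Poisson kernels, each of them nonnegative of total mass 1, and   *)
(* so is at most |B|; then let e tend to 0.                                    *)

(* The hypothesis is tested on indicators of complements of small cubes E inside the ball B. Passing
   from B to B minus E lowers the q-th power of the L^q norm of the transform by at most a constant
   times |E| ([integral_normc_fourier_powR_deficit]), while the hypothesis forces a drop of at least
   c |E|^(n/p). Letting E shrink gives n/p >= 1 ([powR_le_linear_exponent]). The constant is finite
   thanks to one half of Plancherel's identity, [integral_normc_fourier_sqr_le]. That bound follows,
   by Tonelli and monotone convergence, from the Fourier transform of an exponential weight
   ([integral_exp_weight]) and the unit mass of the resulting kernel ([integral_poisson]). *)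
Require Import Defs.
From mathcomp Require Import all_boot all_order all_algebra.
From mathcomp Require Import all_classical all_reals all_analysis.
From mathcomp Require Import complex.
From mathcomp Require Import measurable_realfun ring lra.

Set Implicit Arguments.
Unset Strict Implicit.
Unset Printing Implicit Defensive.

Import Order.TTheory GRing.Theory Num.Theory.
Import numFieldNormedType.Exports.

Local Open Scope classical_set_scope.
Local Open Scope ring_scope.

(** * Integrals on the line *)

Section integrals_on_the_line.
Context {R : realType}.
Implicit Types (f g : R -> R) (e b c m t x y : R).

Lemma is_derive1_continuous f g :
  (forall x, is_derive x 1 f (g x)) -> continuous f.
Proof.
move=> fg x; apply: differentiable_continuous.
by apply/derivable1_diffP; by case: (fg x).
Qed.

(** Folding the line at 0 by the reflection x -> -x leaves a half-line, where an antiderivative with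
    a limit at infinity suffices. *)
Lemma ge0_integralT_itv0y f : continuous f -> (forall x, 0 <= f x) ->
  (\int[lebesgue_measure]_x (f x)%:E =
   \int[lebesgue_measure]_(x in `[0%R, +oo[) (f x + f (- x))%:E)%E.
Proof.
move=> cf f0.
have mf : measurable_fun setT f by exact: continuous_measurable_fun.
have cfN : continuous (f \o -%R).
  by move=> x; apply: continuous_comp; [exact: opp_continuous|exact: cf].
rewrite -(setUv `[0%R, +oo[%classic) ge0_integral_setU//=; last 4 first.
  exact: measurableC.
  by apply/measurable_EFinP; rewrite setUv.
  by move=> x _; rewrite lee_fin.
  exact/disj_setPCl.
rewrite setCitvr integral_itv_bndo_bndc; last first.
  exact/measurable_EFinP/measurable_funTS.
(* Zero is written as [- 0] so that the endpoint of the negative half-line is visibly a reflected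
   point. *)
have <- := @oppr0 R.
rewrite ge0_integration_by_substitutionNy//; last exact: continuous_subspaceT.
rewrite oppr0 -ge0_integralD//.
- by move=> x _; rewrite lee_fin.
- by apply/measurable_EFinP; exact: measurable_funTS.
- by move=> x _; rewrite lee_fin; exact: f0.
- apply/measurable_EFinP; apply: measurable_funTS.
  exact: continuous_measurable_fun.
Qed.

Lemma ge0_integral_itv0y_is_derive f F (l : R) :
  continuous f -> (forall x, 0 <= f x) ->
  (forall x, is_derive x 1 F (f x)) -> F x @[x --> +oo] --> l ->
  (\int[lebesgue_measure]_(x in `[0%R, +oo[) (f x)%:E = (l - F 0)%:E)%E.
Proof.
move=> cf f0 dF Fl; rewrite (@ge0_continuous_FTC2y _ f F 0 l)//.
- exact: continuous_subspaceT.
- by apply: cvg_at_right_filter; exact: (is_derive1_continuous dF).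
- by move=> x _; rewrite derive1E; by case: (dF x).
Qed.

Lemma cvgy_expRMN e : 0 < e -> expR (- (e * x)) @[x --> +oo] --> (0 : R).
Proof.
move=> e0; have ex : e * x @[x --> +oo] --> +oo by exact: gt0_cvgMry.
exact: (cvg_comp (fun x => e * x) (fun x => expR (- x)) ex (@cvgr_expR R)).
Qed.

(** The bound on [c] makes the integrand nonnegative, as [ge0_integral_itv0y_is_derive] requires. *)
Lemma integral_itv0y_exp_cos e b c m : 0 < e -> `|c| <= m ->
  (\int[lebesgue_measure]_(x in `[0%R, +oo[)
     (expR (- (e * x)) * (m + c * cos (b * x)))%:E =
   (m / e + c * (e / (e ^+ 2 + b ^+ 2)))%:E)%E.
Proof.
move=> e0 cm; have eb0 : e ^+ 2 + b ^+ 2 != 0 by nra.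
(* The trigonometric part of this antiderivative is [c] times the real part of exp((-e + ib)x) / (-e
   + ib). *)
pose F x : R := expR (- (e * x)) *
  (- (m / e) + c / (e ^+ 2 + b ^+ 2) * (b * sin (b * x) - e * cos (b * x))).
have dF x : is_derive x 1 F (expR (- (e * x)) * (m + c * cos (b * x))).
  apply: is_derive_eq.
  rewrite !scaler1 /GRing.scale/=.
  field.
  by rewrite eb0 gt_eqF.
rewrite (@ge0_integral_itv0y_is_derive _ F 0)//.
- rewrite /F !mulr0 oppr0 expR0 sin0 cos0; congr EFin; field.
  by rewrite eb0 gt_eqF.
- apply: (@is_derive1_continuous _ (fun x =>
    - e * expR (- (e * x)) * (m + c * cos (b * x))
    - expR (- (e * x)) * (c * b * sin (b * x)))) => x.
  apply: is_derive_eq; rewrite !scaler1 /GRing.scale/=; ring.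
- move=> x; rewrite mulr_ge0 ?expR_ge0//.
  have := cos_max (b * x); have := cm; rewrite !ler_norml; nra.
(* [k] bounds the second factor of [F] uniformly in x, so the exponential drives [F] to 0. *)
- pose k := `|m / e| + `|c / (e ^+ 2 + b ^+ 2)| * (`|b| + `|e|).
  have kF x : - k * expR (- (e * x)) <= F x <= k * expR (- (e * x)).
    rewrite mulNr -ler_norml /F normrM (ger0_norm (expR_ge0 _)) mulrC.
    rewrite ler_wpM2r ?expR_ge0// (le_trans (ler_normD _ _))// normrN lerD2l.
    rewrite normrM ler_wpM2l// (le_trans (ler_normB _ _))// !normrM.
    by rewrite lerD// -[leRHS]mulr1 ler_wpM2l ?sin_max ?cos_max.
  apply: squeeze_cvgr; first by apply: nearW; exact: kF.
  + by rewrite -[X in _ --> X](mulr0 (- k)); apply: cvgMl_tmp; exact: cvgy_expRMN.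
  + by rewrite -[X in _ --> X](mulr0 k); apply: cvgMl_tmp; exact: cvgy_expRMN.
Qed.

(** The part of cos (t + b x) that is odd in x cancels when the line is folded, which leaves 2 cos t
    cos (b x). *)
Lemma integralT_exp_cos e b c m t : 0 < e -> `|c| <= m ->
  (\int[lebesgue_measure]_x
     (expR (- (e * `|x|)) * (m + c * cos (t + b * x)))%:E =
   (m * (2 / e) + c * cos t * (2 * e / (e ^+ 2 + b ^+ 2)))%:E)%E.
Proof.
move=> e0 cm; rewrite ge0_integralT_itv0y.
- transitivity (\int[lebesgue_measure]_(x in `[0%R, +oo[)
    (expR (- (e * x)) * (2 * m + 2 * c * cos t * cos (b * x)))%:E)%E.
    apply: eq_integral => x; rewrite inE/= in_itv/= andbT => x0.
    rewrite normrN ger0_norm// mulrN cosD cosB; congr EFin; ring.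
  rewrite integral_itv0y_exp_cos//; first by congr EFin; field; nra.
  rewrite !normrM ger0_norm// -mulrA ler_pM2l//.
  by rewrite (le_trans _ cm)// -[leRHS]mulr1 ler_wpM2l// cos_max.
- move=> x; apply: cvgM.
    apply: continuous_comp; last exact: continuous_expR.
    apply: cvgN; apply: cvgMl_tmp; exact: norm_continuous.
  apply: cvgD; first exact: cvg_cst.
  apply: cvgMl_tmp; apply: continuous_comp; last exact: continuous_cos.
  by apply: cvgD; [exact: cvg_cst|apply: cvgMl_tmp; exact: cvg_id].
- move=> x; rewrite mulr_ge0 ?expR_ge0//.
  by have := cos_max (t + b * x); have := cm; rewrite !ler_norml; nra.
Qed.

Lemma integralT_poisson_kernel e x : 0 < e ->
  (\int[lebesgue_measure]_y
     (2 * e / (e ^+ 2 + (2 * pi * (x - y)) ^+ 2))%:E = 1)%E.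
Proof.
move=> e0.
have p0 : 0 < pi :> R by exact: pi_gt0.
have den0 y : e ^+ 2 + (2 * pi * y) ^+ 2 != 0.
  by rewrite gt_eqF// ltr_wpDr ?sqr_ge0// exprn_gt0.
pose K y : R := 2 * e / (e ^+ 2 + (2 * pi * y) ^+ 2).
have K0 y : 0 <= K y.
  by rewrite /K divr_ge0 ?addr_ge0 ?sqr_ge0 ?mulr_ge0 ?ltW.
have cK z : continuous (fun y => K (z - y)).
  have dz y : is_derive y 1 (fun y => e ^+ 2 + (2 * pi * (z - y)) ^+ 2)
      (- (2 * pi * 2 * (2 * pi * (z - y)))).
    by apply: is_derive_eq; rewrite /GRing.scale/=; ring.
  move=> y; apply: cvgMl_tmp; apply: cvgV => //.
  exact: (is_derive1_continuous dz).
rewrite (@ge0_integralT_itv0y (fun y => K (x - y)))//.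
(* An antiderivative of the folded kernel. It vanishes at 0 because [atan] is odd, and tends to 1
   because each [atan] tends to pi / 2. *)
pose F y : R :=
  (atan (2 * pi / e * (y - x)) + atan (2 * pi / e * (y + x))) / pi.
have dF y : is_derive y 1 F (K (x - y) + K (x - - y)).
  apply: is_derive_eq; rewrite /GRing.scale/= /K.
  move: p0 den0 {K K0 cK F}; move: (pi : R) => p p0 den0; field.
  by rewrite !den0 !gt_eqF.
have cvg_atan z : atan (2 * pi / e * (y + z)) @[y --> +oo] --> pi / 2.
  have yz : 2 * pi / e * (y + z) @[y --> +oo] --> +oo.
    by apply: gt0_cvgMry; [rewrite divr_gt0 ?mulr_gt0|exact: cvg_addrr].
  exact: (cvg_comp (fun y => 2 * pi / e * (y + z)) atan yz (@cvgy_atan R)).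
rewrite (@ge0_integral_itv0y_is_derive _ F 1)//.
- by rewrite /F !add0r mulrN atanN addNr mul0r subr0.
- move=> y; apply: cvgD; first exact: cK.
  have KN z : K (x - - z) = K (- x - z) by rewrite /K opprK -opprD mulrN sqrrN.
  by rewrite KN; under eq_fun do rewrite KN; exact: cK.
- by move=> y; rewrite addr_ge0.
- have := cvgMr_tmp (b := pi^-1) (cvgD (cvg_atan (- x)) (cvg_atan x)).
  by rewrite -splitr divff ?gt_eqF//; apply.
Qed.

End integrals_on_the_line.

(** * Weights and kernels on R^d *)

Section integrals_on_Rn.
Context {R : realType}.
Implicit Types (e c m t : R) (d : nat).

Local Notation lambda d := (@lebesgue_measure_tuple R d).

Lemma ge0_integral_consT d (f : Rn R d.+1 -> \bar R) :
  measurable_fun setT f -> (forall x, (0 <= f x)%E) ->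
  (\int[lambda d.+1]_x f x =
   \int[lebesgue_measure]_x \int[lambda d]_y f (consT (x, y)))%E.
Proof.
move=> mf f0.
have pushE := ge0_integral_pushforward (@measurable_consT R d)
  (@lebesgue_measure R \x lambda d)%E measurableT mf (fun x _ => f0 x).
transitivity (\int[(@lebesgue_measure R \x lambda d)%E]_x f (consT x))%E.
  exact: pushE.
rewrite fubini_tonelli1//.
by apply: measurableT_comp => //; exact: measurable_consT.
Qed.

Lemma measurable_dotT d :
  measurable_fun setT (fun x : Rn R d * Rn R d => dotT x.1 x.2).
Proof.
apply: measurable_sum => i; apply: measurable_funM.
- exact: (measurableT_comp (measurable_tnth i) measurable_fst).
- exact: (measurableT_comp (measurable_tnth i) measurable_snd).
Qed.

Lemma dotT_consT d (x y : R) (u v : Rn R d) :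
  dotT (consT (x, u)) (consT (y, v)) = x * y + dotT u v.
Proof.
rewrite /dotT big_ord_recl !tnth0; congr (_ + _).
by apply: eq_bigr => i _; rewrite !tnthS.
Qed.

Definition normT1 d (x : Rn R d) : R := \sum_(i < d) `|tnth x i : R|.

Lemma normT1_consT d (x : R) (u : Rn R d) :
  normT1 (consT (x, u)) = `|x| + normT1 u.
Proof.
rewrite /normT1 big_ord_recl tnth0; congr (_ + _).
by apply: eq_bigr => i _; rewrite tnthS.
Qed.

Lemma measurable_normT1 d : measurable_fun setT (@normT1 d).
Proof.
apply: measurable_sum => i; apply: measurableT_comp => //.
exact: measurable_tnth.
Qed.

(* The Fourier transform of [fun s => expR (- (e * `|s|))]. *)
Definition poisson1 e t : R := 2 * e / (e ^+ 2 + (2 * pi * t) ^+ 2).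

Lemma poisson1_ge0 e t : 0 < e -> 0 <= poisson1 e t.
Proof.
by move=> e0; rewrite divr_ge0 ?addr_ge0 ?sqr_ge0 ?mulr_ge0 ?ltW.
Qed.

Lemma poisson1_le e t : 0 < e -> poisson1 e t <= 2 / e.
Proof.
move=> e0; rewrite /poisson1 ler_pdivrMr ?ltr_wpDr ?sqr_ge0 ?exprn_gt0//.
have -> : 2 * e = 2 / e * e ^+ 2 by field; rewrite gt_eqF.
by rewrite mulrDr ler_wpDr// mulr_ge0 ?sqr_ge0// divr_ge0 ?ltW.
Qed.

(** The Fourier transform of [exp_weight e] at x - y, as [integral_exp_weight] shows. *)
Definition poisson d e (x y : Rn R d) : R :=
  \prod_(i < d) poisson1 e (tnth x i - tnth y i).

Lemma poisson_ge0 d e (x y : Rn R d) : 0 < e -> 0 <= poisson e x y.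
Proof. by move=> e0; apply: prodr_ge0 => i _; exact: poisson1_ge0. Qed.

Lemma poisson_le d e (x y : Rn R d) : 0 < e -> poisson e x y <= (2 / e) ^+ d.
Proof.
move=> e0; have <- : \prod_(i < d) (2 / e) = (2 / e) ^+ d.
  by rewrite prodr_const card_ord.
by apply: ler_prod => i _; rewrite poisson1_ge0//= poisson1_le.
Qed.

Lemma poisson_consT d e (x y : R) (u v : Rn R d) :
  poisson e (consT (x, u)) (consT (y, v)) = poisson1 e (x - y) * poisson e u v.
Proof.
rewrite /poisson big_ord_recl !tnth0; congr (_ * _).
by apply: eq_bigr => i _; rewrite !tnthS.
Qed.

Lemma measurable_poisson1 e : measurable_fun setT (poisson1 e).
Proof.
have mden : measurable_fun setT (fun t : R => e ^+ 2 + (2 * pi * t) ^+ 2).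
  apply: measurable_funD => //; apply: (measurable_funX (f := fun t => 2 * pi * t)).
  exact: measurable_funM.
(* The inverse becomes a power with exponent -1, so that [measurable_powR] applies. *)
rewrite (_ : poisson1 e =
    fun t => 2 * e * ((e ^+ 2 + (2 * pi * t) ^+ 2) `^ (- 1))); last first.
  by apply/funext => t; rewrite powR_inv1 // addr_ge0 ?sqr_ge0.
apply: measurable_funM.
  exact: measurable_cst.
exact: (measurableT_comp (measurable_powR (- 1)) mden).
Qed.

Lemma measurable_poisson d e :
  measurable_fun setT (fun xy : Rn R d * Rn R d => poisson e xy.1 xy.2).
Proof.
apply: measurable_prod => i _.
apply: (measurableT_comp (measurable_poisson1 e)).
apply: measurable_funB.
- exact: (measurableT_comp (measurable_tnth i) measurable_fst).
- exact: (measurableT_comp (measurable_tnth i) measurable_snd).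
Qed.

Lemma measurable_poisson2 d e (x : Rn R d) : measurable_fun setT (poisson e x).
Proof. exact: (measurable_fun_pair2 x (measurable_poisson e)). Qed.

Lemma integral_poisson d e (x : Rn R d) : 0 < e ->
  (\int[lambda d]_y (poisson e x y)%:E = 1)%E.
Proof.
move=> e0; elim: d x => [|d IHd] x.
  rewrite /= integral_dirac//.
    by rewrite diracT mul1e /poisson big_ord0.
  by apply/measurable_EFinP; exact: measurable_poisson2.
have -> : x = consT (unconsT x) by rewrite unconsTK.
case: (unconsT x) => x1 u.
rewrite ge0_integral_consT; last 2 first.
- apply/measurable_EFinP; exact: measurable_poisson2.
- by move=> y; rewrite lee_fin poisson_ge0.
transitivity (\int[lebesgue_measure]_y (poisson1 e (x1 - y))%:E)%E; last first.
  exact: integralT_poisson_kernel.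
apply: eq_integral => y _; under eq_integral do rewrite poisson_consT EFinM.
rewrite ge0_integralZl_EFin ?IHd ?mule1// ?poisson1_ge0//.
- by move=> v _; rewrite lee_fin poisson_ge0.
- apply/measurable_EFinP; exact: measurable_poisson2.
Qed.

Definition exp_weight d e (x : Rn R d) : R := expR (- (e * normT1 x)).

Lemma measurable_exp_weight d e : measurable_fun setT (@exp_weight d e).
Proof.
apply: measurableT_comp => //; apply: measurable_funN.
by apply: measurable_funM => //; exact: measurable_normT1.
Qed.

Lemma measurable_cos_dotT d t (x y : Rn R d) : measurable_fun setT
  (fun xi : Rn R d => cos (t + 2 * pi * (dotT x xi - dotT y xi))).
Proof.
apply: measurableT_comp; first exact: (continuous_measurable_fun (@continuous_cos R)).
apply: measurable_funD => //; apply: measurable_funM => //.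
apply: measurable_funB.
- exact: (measurable_fun_pair2 x (@measurable_dotT d)).
- exact: (measurable_fun_pair2 y (@measurable_dotT d)).
Qed.

(* The Fourier transform of the weight, with the nonnegative integrand        *)
(* [m + c * cos] in place of [cos] so that Tonelli's theorem applies, and with *)
(* a phase [t] so that the statement is stable under induction on [d].        *)
Lemma integral_exp_weight d e c m t (x y : Rn R d) : 0 < e -> `|c| <= m ->
  (\int[lambda d]_xi (exp_weight e xi *
     (m + c * cos (t + 2 * pi * (dotT x xi - dotT y xi))))%:E =
   (m * (2 / e) ^+ d + c * cos t * poisson e x y)%:E)%E.
Proof.
move=> e0 cm.
have msr n s c' m' (z w : Rn R n) : measurable_fun setT (fun xi => (exp_weight e xi *
    (m' + c' * cos (s + 2 * pi * (dotT z xi - dotT w xi))))%:E).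
  apply/measurable_EFinP; apply: measurable_funM.
    exact: measurable_exp_weight.
  apply: measurable_funD => //; apply: measurable_funM => //.
  exact: measurable_cos_dotT.
elim: d c m t cm x y => [|d IHd] c m t cm x y.
  rewrite /= integral_dirac//.
    rewrite diracT mul1e /poisson big_ord0 /exp_weight /normT1 /dotT.
    by rewrite !big_ord0 subrr !mulr0 oppr0 expR0 mul1r addr0 expr0 !mulr1.
  exact: msr.
have -> : x = consT (unconsT x) by rewrite unconsTK.
have -> : y = consT (unconsT y) by rewrite unconsTK.
case: (unconsT x) (unconsT y) => [x1 u] [y1 v] {x y}.
have ge0 (s : R) : 0 <= m + c * cos s.
  by have := cos_max s; have := cm; rewrite !ler_norml; nra.
rewrite ge0_integral_consT//; last first.
  by move=> xi; rewrite lee_fin mulr_ge0 ?expR_ge0.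
(* The first coordinate is frozen and absorbed into the phase [s]. The induction hypothesis then
   leaves a one-dimensional integral of the same shape, with new constants in place of [m] and
   [c]. *)
transitivity (\int[lebesgue_measure]_xi1 (expR (- (e * `|xi1|)) *
    (m * (2 / e) ^+ d + c * poisson e u v *
       cos (t + 2 * pi * (x1 - y1) * xi1)))%:E)%E.
  apply: eq_integral => xi1 _; set s := t + 2 * pi * (x1 - y1) * xi1.
  transitivity (\int[lambda d]_xi ((expR (- (e * `|xi1|)))%:E *
      (exp_weight e xi *
         (m + c * cos (s + 2 * pi * (dotT u xi - dotT v xi))))%:E))%E.
    apply: eq_integral => xi _; rewrite -EFinM mulrA /exp_weight.
    rewrite normT1_consT [e * (_ + _)]mulrDr opprD expRD !dotT_consT.
    by congr (_ * (m + c * cos _))%:E; rewrite /s; ring.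
  rewrite ge0_integralZl_EFin ?expR_ge0//.
    by rewrite IHd// -EFinM [_ * cos _ * _]mulrAC.
  - by move=> xi _; rewrite lee_fin mulr_ge0 ?expR_ge0.
  - exact: msr.
(* The new constants still satisfy the domination condition, because the kernel is at most (2 /
   e)^d. *)
have cpm : `|c * poisson e u v| <= m * (2 / e) ^+ d.
  rewrite normrM (ger0_norm (poisson_ge0 _ _ e0)).
  by rewrite ler_pM ?poisson_ge0 ?poisson_le.
rewrite integralT_exp_cos//.
rewrite poisson_consT [_ ^+ d.+1]exprSr -/(poisson1 e (x1 - y1)); congr EFin.
by ring.
Qed.

End integrals_on_Rn.

(** * The L^2 bound for the Fourier transform *)

Lemma EFin_Rintegral d (T : measurableType d) (R : realType)
    (mu : {measure set T -> \bar R}) (f : T -> R) :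
  mu.-integrable setT (EFin \o f) ->
  (\int[mu]_x (f x)%:E = (\int[mu]_x f x)%R%:E)%E.
Proof. by move=> fi; rewrite /Rintegral fineK//; exact: integrable_fin_num. Qed.

Section plancherel.
Context {R : realType} {d : nat}.
Local Notation lambda := (@lebesgue_measure_tuple R d).
Local Notation normc := (@ComplexField.Normc.normc R).

Definition phase (x xi : Rn R d) : R := - (2 * pi * dotT x xi).

Lemma measurable_phase_comp d' (T : measurableType d') (g h : T -> Rn R d) :
  measurable_fun setT g -> measurable_fun setT h ->
  measurable_fun setT (fun t => phase (g t) (h t)).
Proof.
move=> mg mh; apply: measurable_funN; apply: measurable_funM => //.
exact: (measurableT_comp (@measurable_dotT R d) (measurable_fun_pair mg mh)).
Qed.

Lemma measurable_cos_comp d' (T : measurableType d') (g : T -> R) :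
  measurable_fun setT g -> measurable_fun setT (cos \o g).
Proof.
move=> mg; apply: measurableT_comp mg.
exact: (continuous_measurable_fun (@continuous_cos R)).
Qed.

Lemma measurable_sin_comp d' (T : measurableType d') (g : T -> R) :
  measurable_fun setT g -> measurable_fun setT (sin \o g).
Proof.
move=> mg; apply: measurableT_comp mg.
exact: (continuous_measurable_fun (@continuous_sin R)).
Qed.

Context (f : Rn R d -> R).

Definition cosT (xi : Rn R d) : R := \int[lambda]_x (cos (phase x xi) * f x).
Definition sinT (xi : Rn R d) : R := \int[lambda]_x (sin (phase x xi) * f x).

Lemma fourierE xi : fourier f xi = (cosT xi +i* sinT xi)%C.
Proof.
rewrite /fourier /cosT /sinT; congr (_ +i* _)%C.
  by apply: eq_Rintegral => x _ /=; rewrite mulr0 subr0.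
by apply: eq_Rintegral => x _ /=; rewrite mulr0 add0r.
Qed.

Lemma normc_fourier_sqr xi :
  normc (fourier f xi) ^+ 2 = cosT xi ^+ 2 + sinT xi ^+ 2.
Proof. by rewrite fourierE /= sqr_sqrtr// addr_ge0 ?sqr_ge0. Qed.

Context (fi : lambda.-integrable setT (EFin \o f)).
Let mf : measurable_fun setT f.
Proof. by apply/measurable_EFinP; case/integrableP : fi. Qed.

Lemma integrable_bounded_mul (g : Rn R d -> R) :
  measurable_fun setT g -> (forall x, `|g x| <= 1) ->
  lambda.-integrable setT (EFin \o (g \* f)).
Proof.
move=> mg g1; apply: (le_integrable _ _ _ fi) => //.
  by apply/measurable_EFinP; exact: measurable_funM.
by move=> x _ /=; rewrite lee_fin normrM -[leRHS]mul1r ler_wpM2r.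
Qed.

Lemma integrable_cos xi :
  lambda.-integrable setT (EFin \o (fun x => cos (phase x xi) * f x)).
Proof.
apply: (integrable_bounded_mul (g := fun x => cos (phase x xi))); last first.
  by move=> x; exact: cos_max.
by apply: measurable_cos_comp; exact: measurable_phase_comp.
Qed.

Lemma integrable_sin xi :
  lambda.-integrable setT (EFin \o (fun x => sin (phase x xi) * f x)).
Proof.
apply: (integrable_bounded_mul (g := fun x => sin (phase x xi))); last first.
  by move=> x; exact: sin_max.
by apply: measurable_sin_comp; exact: measurable_phase_comp.
Qed.

Lemma integral_lincomb xi (u v w : R) :
  lambda.-integrable setT (EFin \o (fun x =>
    u * f x + (v * (cos (phase x xi) * f x) + w * (sin (phase x xi) * f x)))) /\
  \int[lambda]_x (u * f x +
    (v * (cos (phase x xi) * f x) + w * (sin (phase x xi) * f x))) =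
  u * \int[lambda]_x f x + (v * cosT xi + w * sinT xi).
Proof.
have fu : lambda.-integrable setT (EFin \o (fun x => u * f x)).
  exact: integrableZl fi.
have cv : lambda.-integrable setT (EFin \o (fun x => v * (cos (phase x xi) * f x))).
  exact: integrableZl (integrable_cos xi).
have sw : lambda.-integrable setT (EFin \o (fun x => w * (sin (phase x xi) * f x))).
  exact: integrableZl (integrable_sin xi).
have csvw : lambda.-integrable setT (EFin \o (fun x =>
    v * (cos (phase x xi) * f x) + w * (sin (phase x xi) * f x))).
  exact: integrableD cv sw.
split; first exact: integrableD fu csvw.
rewrite RintegralD// RintegralD// !RintegralZl//.
- exact: integrable_sin.
- exact: integrable_cos.
Qed.

(** The formula for the cosine of a difference separates x from y, so the cosine term integrates to
    [cosT xi ^+ 2 + sinT xi ^+ 2]. *)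
Lemma integral2_cos xi :
  (\int[lambda]_x \int[lambda]_y
     (f x * f y * (1 + cos (phase x xi - phase y xi)))%:E =
   ((\int[lambda]_x f x)%R ^+ 2 + normc (fourier f xi) ^+ 2)%:E)%E.
Proof.
set V := (\int[lambda]_x f x)%R.
transitivity (\int[lambda]_x (V * f x +
    (cosT xi * (cos (phase x xi) * f x) + sinT xi * (sin (phase x xi) * f x)))%:E)%E.
  apply: eq_integral => x _.
  transitivity (\int[lambda]_y (f x * f y +
     (f x * cos (phase x xi) * (cos (phase y xi) * f y) +
      f x * sin (phase x xi) * (sin (phase y xi) * f y)))%:E)%E.
    by apply: eq_integral => y _; rewrite cosB; congr EFin; ring.
  have [ilc elc] := integral_lincomb xi (f x) (f x * cos (phase x xi))
    (f x * sin (phase x xi)).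
  by rewrite EFin_Rintegral// elc; congr EFin; rewrite -/V; ring.
have [ilc elc] := integral_lincomb xi V (cosT xi) (sinT xi).
by rewrite EFin_Rintegral// elc normc_fourier_sqr; congr EFin; rewrite -/V; ring.
Qed.

Context (f01 : forall x, 0 <= f x <= 1).

Let f0 x : 0 <= f x. Proof. by case/andP : (f01 x). Qed.

Let one_cos_ge0 (t : R) : 0 <= 1 + cos t.
Proof. by rewrite -lerBlDl sub0r cos_geN1. Qed.

Let one_sin_ge0 (t : R) : 0 <= 1 + sin t.
Proof. by rewrite -lerBlDl sub0r sin_geN1. Qed.

(** With 1 + cos in place of cos the integrand is nonnegative, so Tonelli's theorem gives
    measurability in xi; the extra term is the constant integral of [f]. *)
Lemma measurable_cosT : measurable_fun setT cosT.
Proof.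
pose g (p : Rn R d * Rn R d) := ((1 + cos (phase p.2 p.1)) * f p.2)%:E.
have mg : measurable_fun setT g.
  apply/measurable_EFinP; apply: measurable_funM.
    apply: measurable_funD => //; apply: measurable_cos_comp.
    by apply: measurable_phase_comp.
  exact: (measurableT_comp mf measurable_snd).
have g0 p : (0 <= g p)%E by rewrite lee_fin mulr_ge0.
have mG := measurable_fun_fubini_tonelli_F (m2 := lambda) _ mg g0.
have -> : cosT = fun xi => fine (fubini_F lambda g xi) - \int[lambda]_x f x.
  apply/funext => xi; apply/eqP; rewrite eq_sym subr_eq; apply/eqP.
  have := integral_lincomb xi 1 1 0; rewrite !mul1r mul0r addr0 addrC => -[_ <-].
  congr fine; apply: eq_integral => x _.
  by rewrite /g/= mul0r addr0 !mul1r mulrDl mul1r.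
by apply: measurable_funB => //; exact: measurableT_comp mG.
Qed.

Lemma measurable_sinT : measurable_fun setT sinT.
Proof.
pose g (p : Rn R d * Rn R d) := ((1 + sin (phase p.2 p.1)) * f p.2)%:E.
have mg : measurable_fun setT g.
  apply/measurable_EFinP; apply: measurable_funM.
    apply: measurable_funD => //; apply: measurable_sin_comp.
    by apply: measurable_phase_comp.
  exact: (measurableT_comp mf measurable_snd).
have g0 p : (0 <= g p)%E by rewrite lee_fin mulr_ge0.
have mG := measurable_fun_fubini_tonelli_F (m2 := lambda) _ mg g0.
have -> : sinT = fun xi => fine (fubini_F lambda g xi) - \int[lambda]_x f x.
  apply/funext => xi; apply/eqP; rewrite eq_sym subr_eq; apply/eqP.
  have := integral_lincomb xi 1 0 1; rewrite !mul1r mul0r add0r addrC => -[_ <-].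
  congr fine; apply: eq_integral => x _.
  by rewrite /g/= mul0r add0r !mul1r mulrDl mul1r.
by apply: measurable_funB => //; exact: measurableT_comp mG.
Qed.

Lemma measurable_normc_fourier : measurable_fun setT (normc \o fourier f).
Proof.
rewrite (_ : _ \o _ = fun xi => Num.sqrt (cosT xi ^+ 2 + sinT xi ^+ 2)); last first.
  by apply/funext => xi; rewrite /comp fourierE.
apply: measurableT_comp.
  exact: (continuous_measurable_fun (@sqrt_continuous R)).
apply: measurable_funD; apply: measurable_funX.
- exact: measurable_cosT.
- exact: measurable_sinT.
Qed.

Let V := \int[lambda]_x f x.

(* Adding [V ^+ 2] to the integrand turns the kernel [cos] of the double       *)
(* integral for the squared modulus into [1 + cos], which is nonnegative.     *)
Lemma integral_exp_weight_normc_fourier_sqr_le (e : R) : 0 < e ->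
  (\int[lambda]_xi (exp_weight e xi * normc (fourier f xi) ^+ 2)%:E <= V%:E)%E.
Proof.
move=> e0.
(* The triple integral of [h] over (xi, x, y) is computed twice: xi outermost produces the
   transform, xi innermost produces the Poisson kernel. *)
pose h (p : Rn R d * Rn R d * Rn R d) : R := exp_weight e p.1.1 *
  (f p.1.2 * f p.2 * (1 + cos (phase p.1.2 p.1.1 - phase p.2 p.1.1))).
have h0 p : 0 <= h p by rewrite !mulr_ge0 ?expR_ge0.
have mh : measurable_fun setT h.
  have m11 : measurable_fun setT (fun p : Rn R d * Rn R d * Rn R d => p.1.1).
    exact: (measurableT_comp measurable_fst measurable_fst).
  have m12 : measurable_fun setT (fun p : Rn R d * Rn R d * Rn R d => p.1.2).
    exact: (measurableT_comp measurable_snd measurable_fst).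
  apply: measurable_funM.
    exact: (measurableT_comp (measurable_exp_weight e) m11).
  apply: measurable_funM.
    apply: measurable_funM.
      exact: (measurableT_comp mf m12).
    exact: (measurableT_comp mf measurable_snd).
  apply: measurable_funD => //; apply: measurable_cos_comp.
  by apply: measurable_funB; exact: measurable_phase_comp.
pose M : R := (2 / e) ^+ d.
have intW : (\int[lambda]_xi (exp_weight e xi)%:E = M%:E)%E.
  have := @integral_exp_weight R d e 0 1 0 [tuple of nseq d 0] [tuple of nseq d 0] e0.
  rewrite normr0 ler01 => /(_ isT); rewrite mul1r !mul0r addr0 => <-.
  by apply: eq_integral => xi _; rewrite mul0r addr0 mulr1.
have V0 : 0 <= V by exact: Rintegral_ge0.
have intV : (\int[lambda]_x (f x)%:E = V%:E)%E by exact: EFin_Rintegral.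
have intxi (x y : Rn R d) : (\int[lambda]_xi (h (xi, x, y))%:E =
    (f x * f y * (M + poisson e x y))%:E)%E.
  transitivity (\int[lambda]_xi ((f x * f y)%:E * (exp_weight e xi *
      (1 + 1 * cos (0 + 2 * pi * (dotT x xi - dotT y xi))))%:E))%E.
    apply: eq_integral => xi _; rewrite -EFinM /h/= mulrCA mul1r -cosN.
    by congr (_ * (_ * (1 + cos _)))%:E; rewrite /phase; ring.
  rewrite ge0_integralZl_EFin ?mulr_ge0//.
  - by rewrite integral_exp_weight ?normr1// cos0 !mul1r.
  - by move=> xi _; rewrite lee_fin mul1r mulr_ge0 ?expR_ge0.
  - apply/measurable_EFinP; apply: measurable_funM.
      exact: measurable_exp_weight.
    apply: measurable_funD => //; apply: measurable_funM => //.
    exact: measurable_cos_dotT.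
have mffp : measurable_fun setT (fun p : Rn R d * Rn R d =>
    (f p.1 * f p.2 * (M + poisson e p.1 p.2))%:E).
  apply/measurable_EFinP; apply: measurable_funM.
    by apply: measurable_funM; exact: (measurableT_comp mf).
  by apply: measurable_funD => //; exact: measurable_poisson.
have M0 : 0 <= M by rewrite exprn_ge0// divr_ge0 ?ltW.
have ffp0 x y : 0 <= f x * f y * (M + poisson e x y).
  by rewrite !mulr_ge0 ?addr_ge0 ?poisson_ge0.
(* The summand [V ^+ 2 * M] is finite and is exactly the contribution of the added constant, so it
   cancels at the end and leaves [V]. *)
have total : (\int[lambda]_xi (exp_weight e xi *
    (V ^+ 2 + normc (fourier f xi) ^+ 2))%:E <= (V ^+ 2 * M + V)%:E)%E.
  have -> : (\int[lambda]_xi (exp_weight e xi *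
      (V ^+ 2 + normc (fourier f xi) ^+ 2))%:E =
      \int[lambda]_xi \int[lambda]_x \int[lambda]_y (h (xi, x, y))%:E)%E.
    apply: eq_integral => xi _; rewrite EFinM -integral2_cos.
    have mg : measurable_fun setT (fun p : Rn R d * Rn R d =>
        (f p.1 * f p.2 * (1 + cos (phase p.1 xi - phase p.2 xi)))%:E).
      apply/measurable_EFinP; apply: measurable_funM.
        by apply: measurable_funM; exact: (measurableT_comp mf).
      apply: measurable_funD => //; apply: measurable_cos_comp.
      by apply: measurable_funB; exact: measurable_phase_comp.
    have g0 x y : (0 <= (f x * f y * (1 + cos (phase x xi - phase y xi)))%:E)%E.
      by rewrite lee_fin !mulr_ge0.
    rewrite -ge0_integralZl_EFin ?expR_ge0//.
    + apply: eq_integral => x _; rewrite -ge0_integralZl_EFin ?expR_ge0//.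
      exact: (measurable_fun_pair2 x mg).
    + by move=> x _; apply: integral_ge0.
    + by apply: (measurable_fun_fubini_tonelli_F (m2 := lambda) _ mg) => -[x y].
  have mh' : measurable_fun setT (fun p => (h p)%:E) by exact/measurable_EFinP.
  have h0' p : (0 <= (h p)%:E)%E by rewrite lee_fin.
  have mF := measurable_fun_fubini_tonelli_F (m2 := lambda) _ mh' h0'.
  have swap_xi x : (\int[lambda]_xi \int[lambda]_y (h (xi, x, y))%:E =
      \int[lambda]_y (f x * f y * (M + poisson e x y))%:E)%E.
    rewrite (fubini_tonelli (fun p => (h (p.1, x, p.2))%:E))//.
      by apply: eq_integral => y _; exact: intxi.
    apply: (measurableT_comp mh'); apply: measurable_fun_pair => //.
    exact: measurable_fun_pair.
  rewrite (fubini_tonelli (fun p => \int[lambda]_y (h (p, y))%:E))%E//; last first.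
    by move=> p; exact: integral_ge0.
  under eq_integral do rewrite swap_xi.
  apply: (@le_trans _ _ (\int[lambda]_x ((V * M + 1)%:E * (f x)%:E))%E); last first.
    rewrite ge0_integralZl_EFin ?addr_ge0 ?mulr_ge0//.
    + by rewrite intV -EFinM lee_fin; lra.
    + by move=> x _; rewrite lee_fin.
    + exact/measurable_EFinP.
  apply: ge0_le_integral => //.
  - by move=> x _; apply: integral_ge0 => y _; rewrite lee_fin.
  - apply: (measurable_fun_fubini_tonelli_F (m2 := lambda) _ mffp) => -[x y].
    by rewrite lee_fin.
  - by apply: measurable_funeM; exact/measurable_EFinP.
  (* In the Poisson term [f y] is bounded by 1, after which the kernel integrates to 1 in y; the
     other term integrates to [f x * M * V]. *)
  move=> x _.
  have mf' : measurable_fun setT (fun y => (f y)%:E) by exact/measurable_EFinP.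
  have mP' : measurable_fun setT (fun y => (poisson e x y)%:E).
    by apply/measurable_EFinP; exact: measurable_poisson2.
  have mfM := measurable_funeM (f x * M)%:E mf'.
  have mP := measurable_funeM (f x)%:E mP'.
  apply: (@le_trans _ _ (\int[lambda]_y ((f x * M)%:E * (f y)%:E +
      (f x)%:E * (poisson e x y)%:E))%E).
    apply: ge0_le_integral => //.
    - by move=> y _; rewrite lee_fin.
    - exact: (measurable_fun_pair2 x mffp).
    - by apply: emeasurable_funD; [exact: mfM|exact: mP].
    - move=> y _; rewrite -!EFinM -EFinD lee_fin mulrDr -mulrA [f y * M]mulrC mulrA.
      rewrite lerD2l mulrAC ler_piMr// ?mulr_ge0 ?poisson_ge0//.
      by case/andP : (f01 y).
  rewrite ge0_integralD//.
  - rewrite !ge0_integralZl_EFin ?mulr_ge0//.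
    + rewrite intV integral_poisson// mule1 -!EFinM -EFinD lee_fin; lra.
    + by move=> y _; rewrite lee_fin poisson_ge0.
    + by move=> y _; rewrite lee_fin.
  - by move=> y _; rewrite -EFinM lee_fin !mulr_ge0.
  - by move=> y _; rewrite -EFinM lee_fin mulr_ge0 ?poisson_ge0.
have mw : measurable_fun setT (fun xi : Rn R d => (exp_weight e xi)%:E).
  by apply/measurable_EFinP; exact: measurable_exp_weight.
have w0 (xi : Rn R d) : (0 <= (exp_weight e xi)%:E)%E by rewrite lee_fin expR_ge0.
have splitE : (\int[lambda]_xi (exp_weight e xi *
    (V ^+ 2 + normc (fourier f xi) ^+ 2))%:E = (V ^+ 2 * M)%:E +
    \int[lambda]_xi (exp_weight e xi * normc (fourier f xi) ^+ 2)%:E)%E.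
  rewrite EFinM -intW -ge0_integralZl_EFin ?sqr_ge0// -ge0_integralD//.
  - by apply: eq_integral => xi _; rewrite -EFinM -EFinD mulrDr [_ * V ^+ 2]mulrC.
  - by move=> xi _; rewrite mule_ge0// lee_fin sqr_ge0.
  - exact: measurable_funeM.
  - by move=> xi _; rewrite lee_fin mulr_ge0 ?expR_ge0 ?sqr_ge0.
  - apply/measurable_EFinP; apply: measurable_funM.
      exact: measurable_exp_weight.
    by apply: measurable_funX; exact: measurable_normc_fourier.
by move: total; rewrite splitE EFinD leeD2lE.
Qed.

(** The weights with e = 1 / (n + 1) increase to 1, and the weighted bound does not depend on e, so
    monotone convergence applies. *)
Lemma integral_normc_fourier_sqr_le :
  (\int[lambda]_xi (normc (fourier f xi) ^+ 2)%:E <= V%:E)%E.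
Proof.
pose g n xi : \bar R :=
  (exp_weight n.+1%:R^-1 xi * normc (fourier f xi) ^+ 2)%:E.
have mg n : measurable_fun setT (g n).
  apply/measurable_EFinP; apply: measurable_funM.
    exact: measurable_exp_weight.
  by apply: measurable_funX; exact: measurable_normc_fourier.
have g0 n xi : (0 <= g n xi)%E by rewrite lee_fin mulr_ge0 ?expR_ge0 ?sqr_ge0.
have ndg xi : {homo g ^~ xi : n m / (n <= m)%N >-> (n <= m)%E}.
  move=> n m nm; rewrite lee_fin ler_wpM2r ?sqr_ge0// ler_expR lerN2.
  by rewrite ler_wpM2r ?sumr_ge0// lef_pV2 ?posrE ?ltr0n// ler_nat ltnS.
have cvg_g xi : g ^~ xi @ \oo --> (normc (fourier f xi) ^+ 2)%:E.
  apply: cvg_EFin; first exact: nearW.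
  rewrite -[X in _ --> X]mul1r -expR0 -oppr0 -(mul0r (normT1 xi)).
  apply: cvgMr_tmp; apply: continuous_cvg; first exact: continuous_expR.
  by apply: cvgN; apply: cvgMr_tmp; exact: cvg_harmonic.
have -> : (\int[lambda]_xi (normc (fourier f xi) ^+ 2)%:E =
    \int[lambda]_xi limn (g ^~ xi))%E.
  by apply: eq_integral => xi _; apply/esym/cvg_lim => //; exact: cvg_g.
have cvgI := cvg_monotone_convergence (mu := lambda) measurableT mg
  (fun n xi _ => g0 n xi) (fun xi _ => ndg xi).
rewrite -(cvg_lim _ cvgI)//; apply: lime_le; first exact: cvgP cvgI.
by apply: nearW => n; exact: integral_exp_weight_normc_fourier_sqr_le.
Qed.

End plancherel.

(** * The L^q deficit *)

(* Young's inequality for the exponents q / (q - 1) and q. *)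
Lemma powR_sub_le (R : realType) (q a b : R) : 1 < q -> 0 <= a -> 0 <= b ->
  a `^ q <= b `^ q + q * a `^ (q - 1) * (a - b).
Proof.
move=> q1 a0 b0; have q0 : 0 < q by lra.
have q10 : 0 < q - 1 by lra.
have conj : (q / (q - 1))^-1 + q^-1 = 1.
  by rewrite invf_div; field; rewrite gt_eqF.
have := conjugate_powR (powR_ge0 a (q - 1)) b0 (divr_gt0 q0 q10) q0 conj.
rewrite -powRrM mulrCA divff ?gt_eqF// mulr1 => young.
have aE : a * a `^ (q - 1) = a `^ q by rewrite mulr_powRB1.
have {}young : q * (a `^ (q - 1) * b) <= (q - 1) * a `^ q + b `^ q.
  apply: (le_trans (ler_wpM2l (ltW q0) young)).
  rewrite le_eqVlt; apply/orP; left; apply/eqP; field.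
  by rewrite !gt_eqF.
rewrite -aE in young *; nra.
Qed.

Section deficit.
Context {R : realType} {d : nat}.
Local Notation lambda := (@lebesgue_measure_tuple R d).
Local Notation normc := (@ComplexField.Normc.normc R).
Implicit Types (f g : Rn R d -> R) (q : R).

Lemma normc_ge0 (z : R[i]) : 0 <= normc z.
Proof. by case: z => a b; exact: sqrtr_ge0. Qed.

Lemma fourierB f g xi :
  lambda.-integrable setT (EFin \o f) -> lambda.-integrable setT (EFin \o g) ->
  fourier (f \- g) xi = fourier f xi - fourier g xi.
Proof.
move=> fi gi; rewrite !fourierE; congr (_ +i* _)%C.
- rewrite /cosT; under eq_Rintegral do rewrite /= mulrBr.
  by rewrite RintegralB//; exact: integrable_cos.
- rewrite /sinT; under eq_Rintegral do rewrite /= mulrBr.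
  by rewrite RintegralB//; exact: integrable_sin.
Qed.

(** The real and imaginary parts are each at most the L^1 norm. The resulting constant 2 is not
    sharp, but it only affects the constant of the final estimate and not its exponents. *)
Lemma normc_fourier_le f xi : lambda.-integrable setT (EFin \o f) ->
  normc (fourier f xi) <= 2 * \int[lambda]_x `|f x|.
Proof.
move=> fi.
have fni : lambda.-integrable setT (EFin \o (fun x => `|f x|)).
  exact: integrable_norm.
have bnd (h : Rn R d -> R) : lambda.-integrable setT (EFin \o h) ->
    (forall x, `|h x| <= `|f x|) ->
    `|\int[lambda]_x h x| <= \int[lambda]_x `|f x|.
  move=> hi hf; rewrite (le_trans (le_normr_Rintegral measurableT hi))//.
  by apply: le_Rintegral => //; exact: integrable_norm.
have C1 : `|cosT f xi| <= \int[lambda]_x `|f x|.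
  apply: bnd => [|x]; first exact: integrable_cos.
  by rewrite normrM -[leRHS]mul1r ler_wpM2r ?cos_max.
have S1 : `|sinT f xi| <= \int[lambda]_x `|f x|.
  apply: bnd => [|x]; first exact: integrable_sin.
  by rewrite normrM -[leRHS]mul1r ler_wpM2r ?sin_max.
have I0 : 0 <= \int[lambda]_x `|f x| by exact: le_trans C1.
rewrite -ler_sqr ?nnegrE ?mulr_ge0 ?normc_ge0//.
rewrite normc_fourier_sqr -[_ ^+ 2]real_normK ?num_real//.
rewrite -[sinT _ _ ^+ 2]real_normK ?num_real//.
have := normr_ge0 (cosT f xi); have := normr_ge0 (sinT f xi); nra.
Qed.

Lemma poweR_LnormC q (h : Rn R d -> R[i]) : q != 0 ->
  (LnormC q h `^ q = \int[lambda]_xi (normc (h xi) `^ q)%:E)%E.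
Proof.
move=> q0; rewrite /LnormC.
rewrite (poweR_Lnorm _ _ q0).
apply: eq_integral => xi _.
rewrite /comp abse_EFin poweR_EFin.
by rewrite ger0_norm ?normc_ge0.
Qed.

Context (f : Rn R d -> R) (fi : lambda.-integrable setT (EFin \o f))
  (f01 : forall x, 0 <= f x <= 1).

Let I := \int[lambda]_x f x.

(** Of the q powers, q - 2 are bounded pointwise by the L^1 estimate and the remaining two are
    handled by the L^2 bound. *)
Lemma integral_normc_fourier_powR_le q : 2 < q ->
  (\int[lambda]_xi (normc (fourier f xi) `^ q)%:E <=
   ((2 * I) `^ (q - 2) * I)%:E)%E.
Proof.
move=> q2.
have n0 (xi : Rn R d) : 0 <= normc (fourier f xi) by exact: normc_ge0.
have nI xi : normc (fourier f xi) <= 2 * I.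
  apply: (le_trans (normc_fourier_le xi fi)); rewrite ler_wpM2l// le_eqVlt.
  apply/orP; left; apply/eqP; apply: eq_Rintegral => x _.
  by rewrite ger0_norm//; case/andP: (f01 x).
have mn := measurable_normc_fourier fi f01.
apply: (@le_trans _ _ (\int[lambda]_xi (((2 * I) `^ (q - 2))%:E *
    (normc (fourier f xi) ^+ 2)%:E))%E).
  apply: ge0_le_integral => //.
  - by move=> xi _; rewrite lee_fin powR_ge0.
  - by apply/measurable_EFinP; exact: (measurableT_comp (measurable_powR q) mn).
  - apply: measurable_funeM; apply/measurable_EFinP.
    exact: (measurable_funX 2 mn).
  - move=> xi _; rewrite -EFinM lee_fin.
    have -> : normc (fourier f xi) `^ q = normc (fourier f xi) `^ (q - 2) *
        normc (fourier f xi) ^+ 2.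
      rewrite -powR_mulrn// -powRD ?subrK//.
      by rewrite gt_eqF//; lra.
    rewrite ler_wpM2r ?sqr_ge0// ge0_ler_powR ?nnegrE//; first lra.
    exact: le_trans (nI xi).
rewrite ge0_integralZl_EFin ?powR_ge0//.
- rewrite EFinM lee_wpmul2l ?lee_fin ?powR_ge0//.
  exact: integral_normc_fourier_sqr_le.
- by move=> xi _; rewrite lee_fin sqr_ge0.
- by apply/measurable_EFinP; exact: (measurable_funX 2 mn).
Qed.

(** Integrate [powR_sub_le], bounding the difference of the moduli by the transform of f - g. The
    remaining power q - 1 of the transform of [f] exceeds 2, hence is integrable. The loss is linear
    in the L^1 distance, with a constant independent of [g]. *)
Lemma integral_normc_fourier_powR_deficit q g : 3 < q ->
  lambda.-integrable setT (EFin \o g) -> (forall x, 0 <= g x <= 1) ->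
  (\int[lambda]_xi (normc (fourier f xi) `^ q)%:E <=
   \int[lambda]_xi (normc (fourier g xi) `^ q)%:E +
   (q * (2 * \int[lambda]_x `|f x - g x|) * ((2 * I) `^ (q - 3) * I))%:E)%E.
Proof.
move=> q3 gi g01; set D := 2 * \int[lambda]_x `|f x - g x|.
have fgi : lambda.-integrable setT (EFin \o (f \- g)).
  exact: (integrableB measurableT fi gi).
have D0 : 0 <= D by rewrite mulr_ge0// Rintegral_ge0.
have n0 (h : Rn R d -> R) xi : 0 <= normc (fourier h xi).
  exact: normc_ge0.
have nD xi : normc (fourier f xi) - normc (fourier g xi) <= D.
  rewrite lerBlDl (le_trans _ (lerD (lexx _) (normc_fourier_le xi fgi)))//.
  rewrite fourierB// -{1}[fourier f xi](subrKC (fourier g xi)).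
  exact: le_normcD.
move: D D0 nD => D D0 nD.
have mf := measurable_normc_fourier fi f01.
have mg := measurable_normc_fourier gi g01.
have mfq r : measurable_fun setT (fun xi => (normc (fourier f xi) `^ r)%:E).
  by apply/measurable_EFinP; exact: (measurableT_comp (measurable_powR r) mf).
have mgq : measurable_fun setT (fun xi => (normc (fourier g xi) `^ q)%:E).
  by apply/measurable_EFinP; exact: (measurableT_comp (measurable_powR q) mg).
apply: (@le_trans _ _ (\int[lambda]_xi ((normc (fourier g xi) `^ q)%:E +
    (q * D)%:E * (normc (fourier f xi) `^ (q - 1))%:E))%E).
  apply: ge0_le_integral.
  - exact: measurableT.
  - by move=> xi _; rewrite lee_fin powR_ge0.
  - exact: mfq.
  - by apply: emeasurable_funD; [exact: mgq|apply: measurable_funeM; exact: mfq].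
  - move=> xi _; rewrite -EFinM -EFinD lee_fin.
    have q1 : 1 < q by lra.
    rewrite (le_trans (powR_sub_le q1 (n0 f xi) (n0 g xi)))// lerD2l.
    rewrite [leRHS]mulrAC ler_wpM2l ?nD// mulr_ge0 ?powR_ge0//; lra.
have qD0 : 0 <= q * D by rewrite mulr_ge0//; lra.
rewrite ge0_integralD.
- rewrite ge0_integralZl_EFin.
  + apply: leeD2l; rewrite [leRHS]EFinM; apply: lee_wpmul2l.
      by rewrite lee_fin.
    have q12 : 2 < q - 1 by lra.
    have -> : q - 3 = q - 1 - 2 by ring.
    exact: integral_normc_fourier_powR_le.
  + exact: measurableT.
  + by move=> xi _; rewrite lee_fin powR_ge0.
  + exact: mfq.
  + exact: qD0.
- exact: measurableT.
- by move=> xi _; rewrite lee_fin powR_ge0.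
- exact: mgq.
- by move=> xi _; rewrite -EFinM lee_fin; apply: mulr_ge0 qD0 _; exact: powR_ge0.
- by apply: measurable_funeM; exact: mfq.
Qed.

End deficit.

(** * Small cubes in the ball *)

Section unit_ball_and_cubes.
Context {R : realType} {d : nat}.
Local Notation lambda := (@lebesgue_measure_tuple R d).

Definition cube (a b : R) : set (Rn R d) :=
  [set x | forall i, `[a, b]%classic (tnth x i : R)].

Lemma measurable_cube a b : measurable (cube a b).
Proof.
rewrite (_ : cube a b = \bigcap_(i : 'I_d) (@tnth _ _ ^~ i) @^-1` `[a, b]%classic).
  apply: fin_bigcap_measurable => [|i _]; first exact: finite_finset.
  by rewrite -[X in measurable X]setTI; exact: measurable_tnth.
by apply/seteqP; split => x /= xab i => [_|]; exact: xab.
Qed.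

Lemma lebesgue_measure_cube a b : a < b -> lambda (cube a b) = ((b - a) ^+ d)%:E.
Proof.
move=> ab; rewrite /cube (@lebesgue_measure_tuple_box R d (fun=> `[a, b]%classic))//.
under eq_bigr do rewrite lebesgue_measure_itv/= lte_fin ab -EFinB.
by rewrite prodEFin prodr_const card_ord.
Qed.

Lemma unit_ballE : unit_ball R d = [set x | dotT x x <= 1].
Proof.
apply/seteqP; split => x /=; rewrite /unit_ball/=.
  by rewrite -[X in _ <= X -> _]sqrtr1 ler_sqrt.
by move=> x1; rewrite -[leRHS]sqrtr1 ler_sqrt.
Qed.

Lemma measurable_unit_ball : measurable (unit_ball R d).
Proof.
have mdot : measurable_fun setT (fun x : Rn R d => dotT x x).
  by apply: measurable_sum => i; apply: measurable_funM; exact: measurable_tnth.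
have := mdot measurableT `]-oo, 1]%classic (measurable_itv _).
by rewrite setTI unit_ballE.
Qed.

Lemma unit_ball_lty : (lambda (unit_ball R d) < +oo)%E.
Proof.
apply: (@le_lt_trans _ _ (lambda (cube (- 1) 1))); last first.
  by rewrite lebesgue_measure_cube ?ltry//; lra.
apply: le_measure; rewrite ?inE; [exact: measurable_unit_ball|exact: measurable_cube|].
rewrite unit_ballE => x /= x1 i.
rewrite /= in_itv/= -ler_norml.
rewrite -(@expr_le1 _ 2)// real_normK ?num_real// (le_trans _ x1)//.
rewrite /dotT (bigD1 i)//= -expr2.
by rewrite lerDl sumr_ge0// => j _; rewrite -expr2 sqr_ge0.
Qed.

(** Since s <= 1, each squared coordinate is at most s, so the squared norm is at most d s <= 1. *)
Lemma cube_sub_unit_ball s : (0 < d)%N -> 0 <= s -> s <= d%:R^-1 ->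
  cube 0 s `<=` unit_ball R d.
Proof.
move=> d0 s0 sd; rewrite unit_ballE => x /= xs.
have d0' : 0 < d%:R :> R by rewrite ltr0n.
have ds1 : s * d%:R <= 1 by rewrite -ler_pdivlMr// mul1r.
apply: (@le_trans _ _ (\sum_(i < d) s)).
  apply: ler_sum => i _; have := xs i; rewrite /= in_itv/= => /andP[x0 xis].
  have d1 : d%:R^-1 <= 1 :> R by rewrite invf_le1// ler1n.
  by rewrite -expr2 (le_trans _ xis)// expr2 ler_piMl// (le_trans xis)// (le_trans sd).
by rewrite sumr_const card_ord -mulr_natr.
Qed.

Lemma integrable_indic_lty (A : set (Rn R d)) :
  measurable A -> (lambda A < +oo)%E -> lambda.-integrable setT (EFin \o \1_A).
Proof.
move=> mA Aoo; apply/integrableP; split.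
  by apply/measurable_EFinP; exact: measurable_indic.
under eq_integral do rewrite /= ger0_norm//.
by rewrite integral_indic// setIT.
Qed.

(** On the ball the function is minus the indicator of E, and a nonzero power of an indicator is
    itself. *)
Lemma Lnorm_ball_indicC (r : R) (E : set (Rn R d)) : r != 0 ->
  measurable E -> E `<=` unit_ball R d ->
  (Lnorm_ball r (fun x => \1_(~` E) x - 1)%R = lambda E `^ r^-1)%E.
Proof.
move=> r0 mE EB; rewrite /Lnorm_ball unlock; congr (_ `^ _)%E.
rewrite -[in RHS](setIT E) -integral_indic//; apply: eq_integral => x _ /=.
have [xE|xE] := pselect (E x).
  rewrite !indicE (memNset (A := ~` E)) ?mem_set//; last exact: EB.
  by rewrite sub0r mulr1 normrN1 powR1.
rewrite !indicE (mem_set (A := ~` E))// (memNset xE).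
by rewrite subrr mul0r normr0 powR0.
Qed.

End unit_ball_and_cubes.

(* Otherwise [c <= K * (s ^+ d) `^ (1 - r)], which fails for small [s]. *)
Lemma powR_le_linear_exponent (R : realType) (d : nat) (c K r s0 : R) :
  (0 < d)%N -> 0 < c -> 0 <= K -> 0 < s0 ->
  (forall s : R, 0 < s -> s <= s0 -> c * (s ^+ d) `^ r <= K * s ^+ d) ->
  1 <= r.
Proof.
move=> d0 c0 K0 s00 cK; rewrite leNgt; apply/negP => r1.
have d0' : 0 < d%:R :> R by rewrite ltr0n.
have t0 : 0 < d%:R * (1 - r) by rewrite mulr_gt0// subr_gt0.
have k0 : 0 < c / (K + 1) by rewrite divr_gt0// ltr_wpDl.
(* The second entry of the minimum solves (s^d)^(1 - r) = c / (K + 1). Using K + 1 avoids division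
   by 0 and makes K c / (K + 1) strictly less than c. *)
pose s := Num.min s0 ((c / (K + 1)) `^ (d%:R * (1 - r))^-1).
have s_gt0 : 0 < s by rewrite lt_min s00 powR_gt0.
have sd0 : 0 < s ^+ d by rewrite exprn_gt0.
have := cK s s_gt0; rewrite ge_min lexx => /(_ isT).
have sk : (s ^+ d) `^ (1 - r) <= c / (K + 1).
  rewrite -(powR_mulrn _ (ltW s_gt0)) -powRrM.
  apply: (@le_trans _ _
    (((c / (K + 1)) `^ (d%:R * (1 - r))^-1) `^ (d%:R * (1 - r)))).
    apply: ge0_ler_powR; rewrite ?nnegrE ?powR_ge0 ?(ltW t0) ?(ltW s_gt0)//.
    by rewrite ge_min lexx orbT.
  by rewrite -powRrM mulVf ?gt_eqF// powRr1// ltW.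
have sE : s ^+ d = (s ^+ d) `^ r * (s ^+ d) `^ (1 - r).
  by rewrite -powRD ?subrKC ?powRr1 ?(ltW sd0)// oner_eq0.
rewrite [X in K * X]sE; move: sk (powR_gt0 r sd0) (powR_gt0 (1 - r) sd0).
move: (_ `^ r) (_ `^ (1 - r)) => u v; rewrite ler_pdivlMr ?ltr_wpDl// => vc u0 v0.
have -> : K * (u * v) = K * v * u by ring.
by rewrite ler_pM2r//; nra.
Qed.

(** Finiteness of [a] forces that of [b] through the last inequality, after which both can be
    cancelled. *)
Lemma le_of_lee_deficit (R : realType) (a b : \bar R) (u v : R) :
  (0 <= a)%E -> (0 <= b)%E -> (a < +oo)%E ->
  (a <= b + v%:E)%E -> (b <= a - u%:E)%E -> u <= v.
Proof.
case: a => [a| |]//; case: b => [b| |]//= _ _ _.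
by rewrite -EFinB -EFinD !lee_fin; lra.
Qed.

(** * Comparison of the two deficits on small cubes *)

Theorem lemma5p2 (R : realType) (d qbar : nat)
    (d_ge1 : (1 <= d)%N) (qbar_ge4 : (4 <= qbar)%N) (qbar_even : ~~ odd qbar) :
  exists delta0 rho : R, [/\ 0 < delta0, 0 < rho &
    forall q n p : R,
      3 < q -> `|q - qbar%:R| <= rho -> 0 < n -> 1 <= p ->
      (exists c : R, 0 < c /\
        forall f : Rn R d -> R,
          measurable_fun setT f ->
          (forall x, 0 <= f x <= 1) ->
          (Lnorm_ball 1 (fun x => f x - 1)%R <= delta0%:E)%E ->
          (LnormC q (fourier (f \* \1_(unit_ball R d))%R) `^ q
             <= LnormC q (fourier \1_(unit_ball R d)) `^ q
                - c%:E * Lnorm_ball p (fun x => f x - 1)%R `^ n)%E) ->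
      p <= n].
Proof.
(* The first witness is [delta0]: the cubes used have side at most 1 / d, hence measure at most 1,
   and this measure is the L^1 distance to the constant 1. *)
exists 1, 1; split => // q n p q3 _ n0 p1 [c [c0 H]].
set B := unit_ball R d in H.
pose lambda := @lebesgue_measure_tuple R d.
have p0 : 0 < p by lra.
have q0 : q != 0 by rewrite gt_eqF//; lra.
have mB : measurable B by exact: measurable_unit_ball.
have Bi : lambda.-integrable setT (EFin \o \1_B).
  exact: integrable_indic_lty mB unit_ball_lty.
have ind01 (A : set (Rn R d)) x : 0 <= (\1_A x : R) <= 1.
  by rewrite indicE; case: (_ \in _); rewrite /= ?lexx ler01.
pose I := \int[lambda]_x (\1_B x : R).
have I0 : 0 <= I by apply: Rintegral_ge0 => x _; case/andP: (ind01 B x).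
(* The constant of [integral_normc_fourier_powR_deficit] per unit of L^1 distance. *)
pose K := q * 2 * ((2 * I) `^ (q - 3) * I).
have K0 : 0 <= K by rewrite !mulr_ge0 ?powR_ge0//; lra.
suff cK s : 0 < s -> s <= d%:R^-1 -> c * (s ^+ d) `^ (n / p) <= K * s ^+ d.
  have := powR_le_linear_exponent d_ge1 c0 K0 _ cK.
  by rewrite invr_gt0 ltr0n d_ge1 => /(_ isT); rewrite ler_pdivlMr// mul1r.
move=> s0 sd; pose E := @cube R d 0 s.
have mE : measurable E by exact: measurable_cube.
have EB : E `<=` B by exact: cube_sub_unit_ball (ltW s0) sd.
have lE : lambda E = (s ^+ d)%:E by rewrite /lambda lebesgue_measure_cube ?subr0.
have sd1 : s ^+ d <= 1.
  rewrite exprn_ile1 ?(ltW s0)// (le_trans sd)// invf_le1 ?ltr0n//.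
  by rewrite ler1n.
have fBE : (\1_(~` E) \* \1_B)%R = \1_(~` E `&` B) :> (Rn R d -> R).
  by rewrite indicI.
have mEB : measurable (~` E `&` B) by apply: measurableI => //; exact: measurableC.
have EBi : lambda.-integrable setT (EFin \o \1_(~` E `&` B)).
  apply: integrable_indic_lty => //; apply: le_lt_trans unit_ball_lty.
  by apply: le_measure; rewrite ?inE//; exact: subIsetr.
have diffE : \int[lambda]_x `|\1_B x - \1_(~` E `&` B) x| = s ^+ d :> R.
  transitivity (\int[lambda]_x (\1_E x : R)); last first.
    by rewrite /Rintegral integral_indic// setIT; exact: (congr1 fine lE).
  apply: eq_Rintegral => x _; rewrite -fBE/= !indicE.
  have [xE|xE] := pselect (E x).
    rewrite (memNset (A := ~` E)) ?(mem_set xE) ?(mem_set (EB x xE))//.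
    by rewrite mul0r subr0 normr1.
  by rewrite (mem_set (A := ~` E))// (memNset xE) mul1r subrr normr0.
have := H \1_(~` E) (measurable_indic (measurableC mE)) (ind01 (~` E)).
rewrite fBE !Lnorm_ball_indicC ?gt_eqF// -/lambda lE !poweR_LnormC//.
rewrite invr1 poweRe1 ?lee_fin ?exprn_ge0 ?(ltW s0)// => /(_ sd1).
rewrite -poweRrM poweR_EFin -EFinM [p^-1 * n]mulrC => ub.
have lb := integral_normc_fourier_powR_deficit Bi (ind01 B) q3 EBi (ind01 _).
have q2 : 2 < q by lra.
(* Finiteness of the norm for the full ball is what allows it to be cancelled between [lb] and
   [ub]. *)
have Aoo := le_lt_trans (integral_normc_fourier_powR_le Bi (ind01 B) q2) (ltry _).
have K_E : q * (2 * s ^+ d) * ((2 * I) `^ (q - 3) * I) = K * s ^+ d.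
  by rewrite /K; ring.
rewrite diffE K_E in lb.
apply: (le_of_lee_deficit _ _ Aoo lb ub).
- by apply: integral_ge0 => xi _; rewrite lee_fin powR_ge0.
- by apply: integral_ge0 => xi _; rewrite lee_fin powR_ge0.
Qed.
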